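(* Let $X$ be a simplicial surface. Then $X$ is face-transitive and the vertex-face type of $X$ satisfies $\mathrm{vf}(X)=(2,2)$ if and only if $H:=\lambda_X(\mathrm{Aut}(X))$ is a $(2,2)$-group of the face graph $\mathcal F(X)$ and the cycle double cover $\mathcal C^{(2,2)}(H)$ (for a suitable choice of the data defining it) contains exactly the vertex-defining cycles of $X$.
   Context: A simplicial complex $X$ on a finite non-empty set $P$ is a non-empty family of subsets of $P$ closed under taking subsets; $X_i$ is the set of its elements of cardinality $i+1$; elements of $X_0,X_1,X_2$ are vertices, edges, faces. A simplicial surface is a simplicial complex $X$ such that: all inclusion-maximal elements have cardinality $3$; every edge lies in exactly two faces; and for every vertex $v$ the faces containing $v$ can be arranged in a cyclic sequence $u(v)=(F_1,\dots,F_n)$ (each once), the umbrella of $v$, with $|F_i\cap F_{i+1}|=2$ (subscripts mod $n$). Simplicial surfaces are assumed strongly connected (any two faces joined by a sequence of faces with consecutive ones sharing an edge). $\mathrm{Aut}(X)$ is the automorphism group (permutations of $X_0$ mapping faces to faces). $X$ is face-transitive if $\mathrm{Aut}(X)$ is transitive on $X_2$; then $\mathrm{vf}(X)=(a,s)$ with $a$ the number of $\mathrm{Aut}(X)$-orbits on $X_0$ and $s$ the order of the stabiliser in $\mathrm{Aut}(X)$ of a face. All graphs are finite, simple, undirected, connected; their elements are called nodes and arcs. The face graph $\mathcal F(X)$ has node set $X_2$, two faces being joined by an arc iff they share an edge; it is cubic. $\lambda_X:\mathrm{Aut}(X)\to\mathrm{Aut}(\mathcal F(X))$ is the injective homomorphism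 sending an automorphism to the permutation it induces on $X_2$. Each umbrella $u(v)$ is a cycle in $\mathcal F(X)$, called a vertex-defining cycle of $X$. Cycles are considered up to rotation and reversal; for a subgroup $H$ of the automorphism group of a graph and a cycle $C$, $C^H$ denotes the $H$-orbit of $C$ under the induced action on cycles. A cycle double cover of a cubic graph is a set of cycles such that every arc lies in exactly two of them. It is vertex-faithful if all its cycles are chordless and any two distinct cycles share at most one arc. $\alpha$-cycles: let $\mathcal G=(V,E)$ be a cubic node-transitive graph (i.e. $\mathrm{Aut}(\mathcal G)$ is transitive on $V$), $F_1,\dots,F_n\in V$ with $\{F_i,F_{i+1}\}\in E$ for $1\le i\le n-1$, and $\sigma\in\mathrm{Aut}(\mathcal G)$ of order $\ell$ with $\sigma(F_1)=F_n$. Put $\Sigma=\{\sigma^i(F_j): 0\le i\le \ell-1,\ 1\le j\le n-1\}$. If $|\Sigma|=(n-1)\ell$, then $\alpha(\sigma,F_1,\dots,F_n)$ is the cycle $(\sigma(F_1),\dots,\sigma(F_{n-1}),\sigma^2(F_1),\dots,\sigma^2(F_{n-1}),\dots,\sigma^\ell(F_1),\dots,\sigma^\ell(F_{n-1}))$; otherwise it is the empty cycle. A subgroup $H\le\mathrm{Aut}(\mathcal G)$ is a $(2,2)$-group of $\mathcal G$ if: (1) $H$ acts transitively on $V$ with $|H|=2|V|$; (2) $E$ partitions into two $H$-orbits $E_1,E_2$ with $|E_1|=|V|$ and $|E_2|=\tfrac12|V|$; (3) there exist nodes $F_m',F_1',F_2'\in V$ with $\{F_1',F_2'\}\in E_1$,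 $\{F_m',F_1'\}\in E_2$ and $\sigma\in H$ with $\sigma(F_m')=F_2'$, such that, with $u$ a mono-coloured cycle of $\mathcal G$ (a cycle all of whose arcs have the same colour, where arcs in $E_i$ have colour $i$), the set $u^H\cup\alpha(\sigma,F_m',F_1',F_2')^H$ is a vertex-faithful cycle double cover of $\mathcal G$. This cover is denoted $\mathcal C^{(2,2)}(H)$. *)

(* Defs.v *)
Set Warnings "-notation-overridden".
From mathcomp Require Import all_boot all_fingroup.

Set Implicit Arguments.
Unset Strict Implicit.
Unset Printing Implicit Defensive.

Local Open Scope nat_scope.

(** * Graphs on a finite type of nodes, given by an adjacency relation *)

Section Graphs.

Variable T : finType.
Implicit Types (e : rel T) (H : {group {perm T}}).

Definition simple_connected_graph e : Prop :=
  [/\ symmetric e, irreflexive e & forall x y, connect e x y].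

Definition cubic e : Prop := forall x, #|[set y | e x y]| = 3.

Definition arcs e : {set {set T}} :=
  [set A : {set T} | [exists x, exists y, e x y && (A == [set x; y])]].

Definition graph_aut e : {set {perm T}} :=
  [set s : {perm T} | [forall x, forall y, e (s x) (s y) == e x y]].

Definition node_transitive e : Prop :=
  [transitive graph_aut e, on [set: T] | 'P].

(** ** Cycles up to rotation and reversal

    A cycle is the set of all node sequences obtained from one of them by
    rotating and reversing.  The bound on the length is harmless, since a cycle
    has pairwise distinct nodes. *)

Definition cyc := {set #|T|.-bseq T}.

Definition same_cycle (s t : seq T) : bool :=
  [exists i : 'I_(size s).+1, (t == rot i s) || (t == rot i (rev s))].

Definition cyc_of (s : seq T) : cyc := [set t : #|T|.-bseq T | same_cycle s t].

(* [path.cycle] and [uniq] also accept sequences of length 0 and 2. *)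
Definition cycle_seq e (s : seq T) : bool := (2 < size s) && ucycleb e s.

Definition graph_cycles e : {set cyc} :=
  [set cyc_of s | s : #|T|.-bseq T & cycle_seq e s].

Definition seq_arcs (s : seq T) : {set {set T}} :=
  [set [set x; next s x] | x in s].

Definition cyc_arcs (C : cyc) : {set {set T}} :=
  \bigcup_(s in C) seq_arcs s.

Definition cyc_nodes (C : cyc) : {set T} :=
  \bigcup_(s in C) [set x in (s : seq T)].

Definition cyc_act (h : {perm T}) (C : cyc) : cyc :=
  [set [bseq of map h s] | s : #|T|.-bseq T in C].

Definition cyc_orbit (H : {set {perm T}}) (C : cyc) : {set cyc} :=
  [set cyc_act h C | h in H].

(** ** Cycle double covers *)

Definition cycle_double_cover e (CC : {set cyc}) : Prop :=
  CC \subset graph_cycles e /\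
  forall A, A \in arcs e -> #|[set C in CC | A \in cyc_arcs C]| = 2.

Definition chordless e (C : cyc) : Prop :=
  forall A, A \in arcs e -> A \subset cyc_nodes C -> A \in cyc_arcs C.

Definition vertex_faithful e (CC : {set cyc}) : Prop :=
  (forall C, C \in CC -> chordless e C) /\
  (forall C D, C \in CC -> D \in CC -> C != D ->
     #|cyc_arcs C :&: cyc_arcs D| <= 1).

(** ** Alpha-cycles

    For [Fs = [:: F_1; ...; F_n]], [take (size Fs).-1 Fs] is
    [[:: F_1; ...; F_(n-1)]].  The empty sequence stands for the empty cycle. *)

Definition alpha_nodes (s : {perm T}) (Fs : seq T) : {set T} :=
  [set (s ^+ i)%g F | i : 'I_(#[s]%g), F : T in take (size Fs).-1 Fs].

Definition alpha (s : {perm T}) (Fs : seq T) : seq T :=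
  if #|alpha_nodes s Fs| == (size Fs).-1 * #[s]%g then
    flatten [seq map (s ^+ i)%g (take (size Fs).-1 Fs) | i <- iota 1 #[s]%g]
  else [::].

(** ** (2,2)-groups *)

Definition arc_orbits22 e H (E1 E2 : {set {set T}}) : Prop :=
  [/\ orbit 'P^* H @: arcs e = [set E1; E2],
      E1 != E2,
      #|E1| = #|T|
    & 2 * #|E2| = #|T|].

Definition mono_coloured (E1 E2 : {set {set T}}) (u : cyc) : bool :=
  (cyc_arcs u \subset E1) || (cyc_arcs u \subset E2).

(* [CC] is the cover C^(2,2)(H) for some choice of Fm', F1', F2', sigma, u. *)
Definition cover22 e H (E1 E2 : {set {set T}}) (CC : {set cyc}) : Prop :=
  exists Fm F1 F2 : T, exists s : {perm T}, exists u : cyc,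
    [/\ [set F1; F2] \in E1 /\ [set Fm; F1] \in E2,
        s \in H /\ s Fm = F2,
        u \in graph_cycles e /\ mono_coloured E1 E2 u,
        CC = cyc_orbit H u :|: cyc_orbit H (cyc_of (alpha s [:: Fm; F1; F2]))
      & cycle_double_cover e CC /\ vertex_faithful e CC].

Definition group22 e H : Prop :=
  [/\ [/\ simple_connected_graph e, cubic e & node_transitive e],
      H \subset graph_aut e,
      [transitive H, on [set: T] | 'P] /\ #|H| = 2 * #|T|
    & exists E1 E2, arc_orbits22 e H E1 E2 /\ exists CC, cover22 e H E1 E2 CC].

Definition is_C22 e H (CC : {set cyc}) : Prop :=
  exists E1 E2, arc_orbits22 e H E1 E2 /\ cover22 e H E1 E2 CC.

End Graphs.

(** * Simplicial surfaces *)

Section Surfaces.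

Variable P : finType.
Implicit Type X : {set {set P}}.

Definition simplicial_complex X : Prop :=
  [/\ 0 < #|P|, X != set0
    & forall A B : {set P}, A \in X -> B \subset A -> B \in X].

Definition simp X (i : nat) : {set {set P}} := [set A in X | #|A| == i.+1].

(* As in [simp X 0], a vertex [v] is a singleton. *)
Definition is_umbrella X (v : {set P}) (s : seq {set P}) : bool :=
  [&& uniq s,
      [forall F : {set P}, (F \in s) == ((F \in simp X 2) && (v \subset F))]
    & path.cycle [rel F G : {set P} | #|F :&: G| == 2] s].

Definition share_edge X : rel {set P} :=
  [rel F G : {set P} | (F != G) && [exists e in simp X 1, (e \subset F) && (e \subset G)]].

Definition face X : finType := {F : {set P} | F \in simp X 2}.

Definition face_graph X : rel (face X) :=
  [rel F G | share_edge X (val F) (val G)].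
Arguments face_graph X : clear implicits.

Definition simplicial_surface X : Prop :=
  [/\ simplicial_complex X,
      forall A : {set P}, maxset (mem X) A -> #|A| = 3,
      forall e, e \in simp X 1 -> #|[set F in simp X 2 | e \subset F]| = 2,
      forall v, v \in simp X 0 -> exists s, is_umbrella X v s
    & forall F G : face X, connect (face_graph X) F G].

(* A permutation of the vertices is a permutation of [P] that fixes every point
   that is not a vertex. *)
Definition surface_aut X : {set {perm P}} :=
  [set s in Sym [set p | [set p] \in X]
     | [forall F in simp X 2, (s @: F) \in simp X 2]].

Lemma surface_aut_group_set X : group_set (surface_aut X).
Proof.
apply/group_setP; split=> [|s t].
  rewrite inE group1; apply/'forall_implyP => F FX.
  by rewrite (eq_imset _ (@perm1 _)) imset_id.
rewrite !inE => /andP[sV /'forall_implyP sX] /andP[tV /'forall_implyP tX].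
rewrite perm_onM //=; apply/'forall_implyP => F FX.
by rewrite (eq_imset _ (permM s t)) (imset_comp t s) tX ?sX.
Qed.

Canonical surface_aut_group X := Group (surface_aut_group_set X).

Definition face_transitive X : Prop :=
  [transitive surface_aut X, on simp X 2 | 'P^*].

(* The second component does not depend on the face that is picked when [X] is
   face-transitive. *)
Definition vf X : nat * nat :=
  (#|orbit 'P^* (surface_aut X) @: simp X 0|,
   #|'C_(surface_aut X)[odflt set0 [pick F in simp X 2] | 'P^*]%g|).

Definition lambda X := actperm ('P^*^? : action _ (face X))%act.

Definition lambda_aut X : {group {perm face X}} :=
  (lambda X @* surface_aut X)%G.

Lemma surface_aut_dom X :
  surface_aut X \subset subact_dom (mem (simp X 2)) 'P^*.
Proof.
apply/subsetP=> s; rewrite !inE => /andP[_ /'forall_implyP sX].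
by apply/subsetP=> F; rewrite inE => FX; rewrite 2!inE; apply: (sX F FX).
Qed.

Lemma lambdaE X (s : {perm P}) (F : face X) :
  s \in surface_aut X -> val (lambda X s F) = s @: val F.
Proof.
move=> sX; rewrite /lambda actpermE val_subact.
by rewrite (subsetP (surface_aut_dom X) s sX).
Qed.

Lemma lambda_autP X (h : {perm face X}) :
  reflect (exists2 s, s \in surface_aut X & forall F, val (h F) = s @: val F)
    (h \in lambda_aut X).
Proof.
apply: (iffP idP).
  by case/morphimP=> s _ sX ->; exists s => // F; apply: lambdaE.
case=> s sX hs; apply/morphimP; exists s => //.
  exact: (subsetP (surface_aut_dom X) s sX).
by apply/permP=> F; apply: val_inj; rewrite hs lambdaE.
Qed.

Definition vertex_defining_cycles X : {set cyc (face X)} :=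
  [set C | [exists v in simp X 0,
     exists s : #|face X|.-bseq (face X),
       is_umbrella X v (map val s) && (C == cyc_of s)]].

End Surfaces.

Arguments face_graph {P} X.

(* Main.v *)
Require Import Defs.
From mathcomp Require Import all_boot all_fingroup cyclic.

(** Each vertex [p] of a surface determines the set [star p] of faces around it.
    A face has at most two neighbours in [star p], so the umbrella of [p] is the
    unique Hamiltonian cycle of [star p]; the vertex-defining cycles therefore
    correspond bijectively and equivariantly to the vertices, and the arcs of
    such a cycle are the arcs contained in [star p].

    If the type is (2,2), the nontrivial automorphism stabilising a face
    exchanges two of its vertices and fixes the third.  The orbit [A] of the
    fixed vertex meets every face in exactly one vertex, and the automorphism
    group is transitive on the pairs (face, vertex of the face) of either kind.
    The arcs contained in the star of a vertex of [A] form one orbit, the others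
    form a perfect matching; vertices of [A] have mono-coloured cycles, and
    the colours alternate around any other vertex, whose cycle is the
    alpha-cycle of the automorphism rotating it by two steps.

    Conversely, the vertices have at most two orbits since their cycles do; a
    single orbit would make all cycles mono-coloured in the same colour, so that
    the arcs of the other colour would not be covered. *)

Set Implicit Arguments.
Unset Strict Implicit.
Unset Printing Implicit Defensive.

(** * Hamiltonian cycles of sets of degree at most two *)

Section HamiltonianCycles.

Variables (T : finType) (e : rel T).
Hypothesis e_sym : symmetric e.
Implicit Types (N : {set T}) (s t : seq T) (h : {perm T}).

(** The conjuncts mirror those of [is_umbrella]. Sequences of length at most two are not excluded,
    hence the assumption [2 < #|N|] in later lemmas. *)
Definition hamiltonian N s : bool :=
  [&& uniq s, [forall x, (x \in s) == (x \in N)] & path.cycle e s].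

(** No representative is chosen, so an automorphism acts on this cycle through its action on [N]
    alone. The degree bound makes it a single cycle, see [cyc_of_hamiltonian]. *)
Definition ham_cyc N : cyc T := [set s : #|T|.-bseq T | hamiltonian N s].

Definition degree_le2 N : Prop := forall x y1 y2 y3,
  x \in N -> y1 \in N -> y2 \in N -> y3 \in N ->
  e x y1 -> e x y2 -> e x y3 -> y1 != y2 -> y1 != y3 -> y2 = y3.

Lemma hamiltonianP N s :
  reflect [/\ uniq s, s =i N & path.cycle e s] (hamiltonian N s).
Proof.
apply: (iffP and3P) => [[Us /forallP sN cs]|[Us sN cs]]; split=> //.
  by move=> x; apply/eqP.
by apply/forallP=> x; rewrite sN.
Qed.

Lemma hamiltonian_size N s : hamiltonian N s -> size s = #|N|.
Proof. by case/hamiltonianP=> /card_uniqP <- sN _; apply: eq_card. Qed.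

Lemma hamiltonian_bseq N s :
  hamiltonian N s -> exists t : #|T|.-bseq T, t = s :> seq T.
Proof.
move=> hs; have le_s : size s <= #|T| by rewrite (hamiltonian_size hs) max_card.
by exists (Bseq le_s).
Qed.

Lemma hamiltonian_rot N i s : hamiltonian N (rot i s) = hamiltonian N s.
Proof.
rewrite /hamiltonian rot_uniq rot_cycle; congr [&& _, _ & _].
by apply: eq_forallb => x; rewrite mem_rot.
Qed.

Lemma hamiltonian_rev N s : hamiltonian N (rev s) = hamiltonian N s.
Proof.
rewrite /hamiltonian rev_uniq rev_cycle; congr [&& _, _ & _].
  by apply: eq_forallb => x; rewrite mem_rev.
by apply: eq_cycle => x y; rewrite e_sym.
Qed.

Lemma next_next_neq s x :
  uniq s -> 2 < size s -> x \in s -> next s (next s x) != x.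
Proof.
move=> Us s_gt2 /rot_to[i s' Ds].
have: size (x :: s') > 2 by rewrite -Ds size_rot.
have: uniq (x :: s') by rewrite -Ds rot_uniq.
rewrite -!(next_rot i Us) Ds; case: s' {Ds} => [|y [|z s']] //=.
rewrite !inE !negb_or => /andP[/and3P[xy xz _] _] _.
by rewrite eqxx /= (eq_sym y) (negPf xy) eqxx eq_sym.
Qed.

Lemma next_neq_prev s x :
  uniq s -> 2 < size s -> x \in s -> next s x != prev s x.
Proof.
move=> Us s_gt2 xs; apply: contra (next_next_neq Us s_gt2 xs) => /eqP ->.
by rewrite next_prev.
Qed.

Lemma next_adj s x : path.cycle e s -> x \in s -> e x (next s x).
Proof. exact: next_cycle. Qed.

Lemma prev_adj s x : path.cycle e s -> x \in s -> e x (prev s x).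
Proof. by move=> cs xs; rewrite e_sym prev_cycle. Qed.

(** Since the cycle has more than two nodes, [next s x] and [prev s x] are distinct and use up the
    two neighbours that [x] can have in [N]. *)
Lemma neighbour_in_cycle N s x y :
    degree_le2 N -> uniq s -> 2 < size s -> path.cycle e s -> {subset s <= N} ->
  x \in s -> y \in N -> e x y -> y = next s x \/ y = prev s x.
Proof.
move=> d2 Us s_gt2 cs sN xs yN exy.
have [->|y_next] := eqVneq y (next s x); [by left | right].
have := next_neq_prev Us s_gt2 xs; rewrite eq_sym in y_next => np.
by apply: (d2 x (next s x)); rewrite ?next_adj ?prev_adj // ?sN ?mem_next ?mem_prev.
Qed.

(** Walk along [t] from a node of [s]: each step leads to a neighbour in [N], which is a neighbour
    along [s], so the walk never leaves [s]. *)
Lemma cycle_exhausts N s t :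
    degree_le2 N -> uniq s -> 2 < size s -> path.cycle e s -> {subset s <= N} ->
  hamiltonian N t -> hamiltonian N s.
Proof.
move=> d2 Us s_gt2 cs sN /hamiltonianP[Ut tN ct].
apply/hamiltonianP; split=> // x; apply/idP/idP; first exact: sN.
rewrite -tN => xt; have [y ys] : exists y, y \in s.
  by case: (s) s_gt2 => // y s' _; exists y; rewrite inE eqxx.
have yt : y \in t by rewrite tN sN.
have yx : fconnect (next t) y x by rewrite (fconnect_cycle (cycle_next Ut)).
rewrite -(iter_findex yx); elim: (findex _ _ _) => //= n IHn.
set z := iter n _ _ in IHn *; have zt : z \in t by rewrite tN sN.
have := neighbour_in_cycle d2 Us s_gt2 cs sN IHn _ (next_adj ct zt).
by rewrite -tN mem_next zt => -[] // ->; rewrite ?mem_next ?mem_prev.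
Qed.

(** [z] is the node visited before [y]: one of the at most two neighbours of [y] in [N] is already
    used, so the next node is forced at every step. *)
Lemma path_unique N z y s t :
    degree_le2 N -> {subset z :: y :: s <= N} -> {subset t <= N} ->
    uniq (z :: y :: s) -> uniq (z :: y :: t) -> e z y -> path e y s ->
  path e y t -> size s = size t -> s = t.
Proof.
move=> d2; elim: s t z y => [|a s IHs] [|b t] //= z y sN tN Us Ut ezy.
case/andP=> eya pas /andP[eyb pbt] [st].
have zN : z \in N by apply: sN; rewrite !inE eqxx.
have yN : y \in N by apply: sN; rewrite !inE eqxx !orbT.
have aN : a \in N by apply: sN; rewrite !inE eqxx !orbT.
have bN : b \in N by apply: tN; rewrite !inE eqxx.
have za : z != a by case/and3P: Us; rewrite !inE !negb_or => /and3P[].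
have zb : z != b by case/and3P: Ut; rewrite !inE !negb_or => /and3P[].
have ab : a = b by apply: (d2 y z); rewrite // e_sym.
subst b; congr (_ :: _); apply: (IHs t y a) => //.
- by move=> x xs; apply: sN; rewrite inE xs orbT.
- by move=> x xt; apply: tN; rewrite inE xt orbT.
- by case/andP: Us.
- by case/andP: Ut.
Qed.

Lemma hamiltonian_next_rot N s t x :
    degree_le2 N -> 2 < #|N| -> hamiltonian N s -> hamiltonian N t ->
  x \in N -> next s x = next t x -> exists2 i, i <= size s & t = rot i s.
Proof.
move=> d2 N_gt2 hs ht xN st.
have /hamiltonianP[Us sN cs] := hs; have /hamiltonianP[Ut tN ct] := ht.
have /rot_to[i s' Ds] : x \in s by rewrite sN.
have /rot_to[j t' Dt] : x \in t by rewrite tN.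
suff st' : s' = t'.
  (* Turn [s] to start at [x], then undo the rotation by [j] that made [t] start at [x]. *)
  exists (rot_add s i (size (rot j t) - j)); first exact: leq_rot_add.
  by rewrite -rot_rot_add Ds st' -Dt -/(rotr j _) rotK.
have := hamiltonian_rot N i s; have := hamiltonian_rot N j t.
move: st; rewrite -(next_rot i Us) -(next_rot j Ut) hs ht Ds Dt => st ht' hs'.
have := hamiltonian_size ht'; have := hamiltonian_size hs'.
(* As [N] has more than two nodes, both sequences have a second node, the same one by [st]. *)
case: t' => [|w t'] in {Dt} ht' st *; first by move=> _ sN1; rewrite -sN1 in N_gt2.
case: s' => [|y s'] in {Ds} hs' st *; first by move=> sN1; rewrite -sN1 in N_gt2.
move=> szs szt; move: st; rewrite /= eqxx => yw; subst y; congr (_ :: _).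
have /hamiltonianP[Us' sN' /= /andP[exw ps]] := hs'.
have /hamiltonianP[Ut' tN' /= /andP[_ pt]] := ht'.
rewrite !rcons_path in ps pt; case/andP: ps => ps _; case/andP: pt => pt _.
apply: (path_unique d2 _ _ Us' Ut') => // [z||]; first by rewrite sN'.
  by move=> z zt; rewrite -tN' !inE zt !orbT.
by apply/eqP; rewrite -2!eqSS; apply/eqP; rewrite -[LHS]/(size [:: x, w & s']) szs -szt.
Qed.

(** At any node [x], [next t x] is the successor or the predecessor of [x] along [s]; the second
    case reduces to the first by reversing [s]. *)
Lemma hamiltonian_same_cycle N s t :
    degree_le2 N -> 2 < #|N| -> hamiltonian N s -> hamiltonian N t ->
  same_cycle s t.
Proof.
move=> d2 N_gt2 hs ht.
have /hamiltonianP[Us sN cs] := hs; have /hamiltonianP[Ut tN ct] := ht.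
have [x xN] : exists x, x \in N by apply/card_gt0P/(leq_trans _ N_gt2).
have xs : x \in s by rewrite sN.
have s_gt2 : 2 < size s by rewrite (hamiltonian_size hs).
have /(neighbour_in_cycle d2 Us s_gt2 cs _ xs) : next t x \in N.
  by rewrite -tN mem_next tN.
case=> [z||E|E]; [by rewrite sN|by apply: next_adj; rewrite // tN| |].
  have [i le_i ->] := hamiltonian_next_rot d2 N_gt2 hs ht xN (esym E).
  by apply/existsP; exists (Ordinal (le_i : i < (size s).+1)); rewrite eqxx.
have hr : hamiltonian N (rev s) by rewrite hamiltonian_rev.
have [] := hamiltonian_next_rot d2 N_gt2 hr ht xN; first by rewrite next_rev.
rewrite size_rev => i le_i ->.
by apply/existsP; exists (Ordinal (le_i : i < (size s).+1)); rewrite eqxx orbT.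
Qed.

Lemma same_cycle_hamiltonian N s t :
  same_cycle s t -> hamiltonian N s -> hamiltonian N t.
Proof.
by case/existsP=> i /orP[]/eqP->; rewrite hamiltonian_rot ?hamiltonian_rev.
Qed.

Lemma cyc_of_hamiltonian N s :
  degree_le2 N -> 2 < #|N| -> hamiltonian N s -> cyc_of s = ham_cyc N.
Proof.
move=> d2 N_gt2 hs; apply/setP=> t; rewrite !inE.
apply/idP/idP=> [/same_cycle_hamiltonian|]; first exact.
exact: hamiltonian_same_cycle.
Qed.

Lemma ham_cyc_in_graph_cycles N s :
    degree_le2 N -> 2 < #|N| -> hamiltonian N s ->
  ham_cyc N \in graph_cycles e.
Proof.
move=> d2 N_gt2 hs; have [t Dt] := hamiltonian_bseq hs.
apply/imsetP; exists t; last by rewrite Dt (cyc_of_hamiltonian d2).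
have /hamiltonianP[Us _ cs] := hs.
by rewrite inE Dt /cycle_seq (hamiltonian_size hs) N_gt2 /ucycleb cs.
Qed.

Lemma in_arcs x y : ([set x; y] \in arcs e) = e x y.
Proof.
rewrite inE; apply/existsP/idP=> [[a /existsP[b /andP[eab /eqP Dab]]]|exy].
  have: a \in [set x; y] by rewrite Dab !inE eqxx.
  have: b \in [set x; y] by rewrite Dab !inE eqxx orbT.
  have: x \in [set a; b] by rewrite -Dab !inE eqxx.
  have: y \in [set a; b] by rewrite -Dab !inE eqxx orbT.
  rewrite !inE.
  by do 4![case/orP=> /eqP ?; subst=> //]; rewrite // e_sym.
by exists x; apply/existsP; exists y; rewrite exy eqxx.
Qed.

Lemma arcsP A :
  reflect (exists x y, e x y /\ A = [set x; y]) (A \in arcs e).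
Proof.
apply: (iffP idP) => [|[x [y [exy ->]]]]; last by rewrite in_arcs.
rewrite inE => /existsP[x /existsP[y /andP[exy /eqP ->]]].
by exists x, y.
Qed.

(** An arc inside [N] joins a node to its successor or predecessor along [s], so there are no chords
    and the arcs of the cycle depend on [N] only. *)
Lemma seq_arcs_hamiltonian N s :
    degree_le2 N -> 2 < #|N| -> hamiltonian N s ->
  seq_arcs s = [set A in arcs e | A \subset N].
Proof.
move=> d2 N_gt2 hs; have /hamiltonianP[Us sN cs] := hs.
have s_gt2 : 2 < size s by rewrite (hamiltonian_size hs).
apply/setP=> A; rewrite inE; apply/imsetP/andP=> [[x xs ->]|[]].
  rewrite in_arcs next_adj // subUset !sub1set -!sN mem_next.
  by rewrite xs.
case/arcsP=> x [y [exy ->]]; rewrite subUset !sub1set => /andP[xN yN].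
have xs : x \in s by rewrite sN.
case: (neighbour_in_cycle d2 Us s_gt2 cs _ xs yN exy) => [z|->|->].
- by rewrite sN.
- by exists x; rewrite ?inE.
by exists (prev s x); rewrite ?inE ?mem_prev // next_prev // setUC.
Qed.

Lemma cyc_arcs_ham N s :
    degree_le2 N -> 2 < #|N| -> hamiltonian N s ->
  cyc_arcs (ham_cyc N) = [set A in arcs e | A \subset N].
Proof.
move=> d2 N_gt2 hs; apply/setP=> A; apply/bigcupP/idP=> [[t]|AN].
  by rewrite inE => ht; rewrite (seq_arcs_hamiltonian d2).
have [t Dt] := hamiltonian_bseq hs.
by exists t; rewrite ?inE Dt // (seq_arcs_hamiltonian d2 _ hs).
Qed.

Lemma cyc_nodes_ham N s : hamiltonian N s -> cyc_nodes (ham_cyc N) = N.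
Proof.
move=> hs; apply/setP=> x; apply/bigcupP/idP=> [[t]|xN].
  by rewrite !inE => /hamiltonianP[_ <- _].
have [t Dt] := hamiltonian_bseq hs; have /hamiltonianP[_ sN _] := hs.
by exists t; rewrite ?inE Dt // sN.
Qed.

Lemma hamiltonian_map N s h :
    h \in graph_aut e -> hamiltonian N s ->
  hamiltonian [set h x | x in N] (map h s).
Proof.
rewrite inE => /forallP e_h /hamiltonianP[Us sN cs].
apply/hamiltonianP; split.
- by rewrite map_inj_uniq //; apply: perm_inj.
- move=> x; apply/mapP/imsetP=> [] [y]; rewrite -?sN => yN ->; exists y => //.
    by rewrite -sN.
- rewrite cycle_map; apply: etrans cs; apply: eq_cycle => x y /=.
  by have /forallP/(_ y)/eqP := e_h x.
Qed.

End HamiltonianCycles.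

(** * Graph automorphisms and double counting *)

Lemma graph_autP (T : finType) (e : rel T) (h : {perm T}) :
  reflect (forall x y, e (h x) (h y) = e x y) (h \in graph_aut e).
Proof.
rewrite inE; apply: (iffP 'forall_forallP) => e_h x y; last exact/eqP.
exact/eqP/e_h.
Qed.

Lemma graph_autV (T : finType) (e : rel T) (h : {perm T}) :
  h \in graph_aut e -> (h^-1)%g \in graph_aut e.
Proof.
by move/graph_autP=> e_h; apply/graph_autP=> x y; rewrite -e_h !permKV.
Qed.

Lemma cyc_act_ham (T : finType) (e : rel T) (N : {set T}) (h : {perm T}) :
    h \in graph_aut e ->
  cyc_act h (ham_cyc e N) = ham_cyc e [set h x | x in N].
Proof.
move=> e_h; apply/setP=> t; rewrite inE; apply/imsetP/idP=> [[s]|ht].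
  by rewrite inE => hs ->; apply: hamiltonian_map.
exists [bseq of map (h^-1)%g t]; last first.
  by apply: val_inj; rewrite /= -map_comp map_id_in // => x _ /=; rewrite permKV.
rewrite inE; have := hamiltonian_map (graph_autV e_h) ht; congr hamiltonian.
by rewrite -imset_comp (eq_imset _ (permK h)) imset_id.
Qed.

(** Double counting of the pairs of a block and an element of it. It yields the number of arcs of
    each colour. *)
Lemma card_uniform_cover (T : finType) (E : {set {set T}}) d k :
    (forall B, B \in E -> #|B| = d) ->
    (forall x, #|[set B in E | x \in B]| = k) ->
  d * #|E| = k * #|T|.
Proof.
move=> Ed Ek; transitivity (\sum_(B in E) #|B|).
  by rewrite (eq_bigr _ Ed) sum_nat_const mulnC.
transitivity (\sum_x #|[set B in E | x \in B]|); last first.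
  by rewrite (eq_bigr (fun=> k)) // sum_nat_const mulnC.
under eq_bigr do rewrite -sum1_card.
under [RHS]eq_bigr do rewrite -sum1_card.
rewrite (exchange_big_dep predT) //=; apply: eq_bigr => x _.
by apply: eq_bigl => B; rewrite inE.
Qed.

Lemma cyc_act1 (T : finType) (C : cyc T) : cyc_act 1%g C = C.
Proof.
rewrite /cyc_act -[RHS]imset_id; apply: eq_imset => s; apply: val_inj => /=.
by rewrite (eq_map (@perm1 _)) map_id.
Qed.

(** * Stars and automorphisms of a surface *)

Section SurfaceStructure.

Variables (P : finType) (X : {set {set P}}).
Hypothesis surfX : simplicial_surface X.

Local Notation e := (face_graph X).
Implicit Types (F G : face X) (p q : P) (g h : {perm P}).

(** Points of [P] rather than the singletons of [simp X 0], so that automorphisms act on them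
    directly. *)
Definition vertices : {set P} := [set p | [set p] \in X].
Definition star p : {set face X} := [set F : face X | p \in val F].

Lemma card_face F : #|val F| = 3.
Proof. by have:= valP F; rewrite inE => /andP[_ /eqP]. Qed.

Lemma sub_face F (A : {set P}) : A \subset val F -> A \in X.
Proof.
have [[_ _ closedX] _ _ _ _] := surfX.
by apply: closedX; have:= valP F; rewrite inE => /andP[].
Qed.

Lemma face_vertex F p : p \in val F -> p \in vertices.
Proof. by rewrite inE -sub1set; apply: sub_face. Qed.

Lemma exists_face_over (A : {set P}) : A \in X -> exists F, A \subset val F.
Proof.
have [_ max3 _ _ _] := surfX => AX.
have [B maxB sAB] := maxset_exists (AX : mem X A).
have BX2 : B \in simp X 2 by rewrite inE (max3 B) // andbT; apply: (maxsetp maxB).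
by exists (Sub B BX2); rewrite SubK.
Qed.

Lemma vertex_in_face p : p \in vertices -> exists F, p \in val F.
Proof. by rewrite inE => /exists_face_over[F]; rewrite sub1set; exists F. Qed.

Lemma exists_face : exists F0 : face X, true.
Proof.
have [[_ /set0Pn[A AX] _] _ _ _ _] := surfX.
by have [F _] := exists_face_over AX; exists F.
Qed.

(** Two faces over a common edge meet in at least two points, and meeting in three would make them
    equal. This reconciles adjacency in the face graph with the condition used in umbrellas. *)
Lemma adjE F G : e F G = (#|val F :&: val G| == 2).
Proof.
rewrite /= /share_edge /=; apply/andP/idP=> [[FG /existsP[A]]|FG2].
  rewrite !inE => /andP[/andP[_ /eqP A2] /andP[AF AG]].
  rewrite eqn_leq -[X in _ && (X <= _)]A2 subset_leq_card ?subsetI ?AF // andbT.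
  rewrite leqNgt; apply: contra FG => FG3.
  have subF : val F :&: val G == val F.
    by rewrite eqEcard subsetIl card_face.
  by rewrite eqEcard !card_face andbT -(eqP subF) subsetIr.
split; last first.
  apply/existsP; exists (val F :&: val G).
  by rewrite inE FG2 subsetIl subsetIr (sub_face (subsetIl _ _)).
by apply: contraTneq FG2 => ->; rewrite setIid card_face.
Qed.

Lemma adj_sym : symmetric e.
Proof. by move=> F G; rewrite !adjE setIC. Qed.

Lemma adj_irr : irreflexive e.
Proof. by move=> F; rewrite adjE setIid card_face. Qed.

(** * Neighbouring faces and opposite vertices *)

Lemma card_faceD1 F q : q \in val F -> #|val F :\ q| = 2.
Proof. by move=> qF; have:= card_face F; rewrite (cardsD1 q) qF => -[]. Qed.

Lemma adj_setI F G q :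
  e F G -> q \in val F -> q \notin val G -> val F :&: val G = val F :\ q.
Proof.
rewrite adjE => /eqP FG2 qF qG; apply/eqP; rewrite eqEcard FG2 card_faceD1 //.
rewrite andbT.
apply/subsetP=> r; rewrite !inE => /andP[-> rG]; rewrite andbT.
by apply: contraNneq qG => <-.
Qed.

Lemma adj_in F G q r : e F G -> q \in val F -> q \notin val G ->
  r \in val F -> r != q -> r \in val G.
Proof.
move=> eFG qF qG rF rq.
have: r \in val F :\ q by rewrite !inE rq.
by rewrite -(adj_setI eFG qF qG) inE => /andP[].
Qed.

Lemma adj_opposite F G : e F G -> exists2 q, q \in val F & q \notin val G.
Proof.
rewrite adjE => /eqP FG2; have: ~~ (val F \subset val G).
  by apply/negP=> /setIidPl FG; rewrite FG card_face in FG2.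
by case/subsetPn=> q; exists q.
Qed.

Lemma card_edge_faces (A : {set P}) :
  A \in simp X 1 -> #|[set F : face X | A \subset val F]| = 2.
Proof.
have [_ _ edge2 _ _] := surfX => /edge2; apply: etrans.
rewrite -(card_imset _ val_inj); apply: eq_card => B.
apply/imsetP/idP=> [[F]|]; rewrite inE; first by move=> AF ->; rewrite inE (valP F).
by case/andP=> BX2 AB; exists (Sub B BX2); rewrite ?inE SubK.
Qed.

Lemma edge_of_face F q : q \in val F -> val F :\ q \in simp X 1.
Proof.
by move=> qF; rewrite inE (sub_face (subD1set _ _)) card_faceD1.
Qed.

(** Otherwise [F], [G] and [G'] would be three faces over the edge [val F :\ q]. Hence a neighbour
    of [F] is determined by its opposite vertex, the vertex of [F] that it misses. *)
Lemma opposite_inj F G G' q : e F G -> e F G' ->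
  q \in val F -> q \notin val G -> q \notin val G' -> G = G'.
Proof.
move=> eFG eFG' qF qG qG'; apply/eqP/negPn/negP => GG'.
have:= card_edge_faces (edge_of_face qF); apply/eqP; rewrite neq_ltn.
apply/orP; right; suff <- : #|[set F; G; G']| = 3.
  apply/subset_leq_card/subsetP=> H.
  rewrite !inE => /orP[/orP[]|]/eqP->; first exact: subD1set.
    by rewrite -(adj_setI eFG qF qG) subsetIr.
  by rewrite -(adj_setI eFG' qF qG') subsetIr.
have neq G1 : e F G1 -> F != G1 by apply: contraTneq => <-; rewrite adj_irr.
by rewrite setUC cardsU1 !inE cards2 neq // negb_or ![G' == _]eq_sym neq // GG'.
Qed.

(** The second face over the edge [val F :\ q]. With [opposite_inj] this makes the neighbours of [F]
    correspond bijectively to its vertices. *)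
Lemma exists_opposite F q :
  q \in val F -> exists2 G, e F G & q \notin val G.
Proof.
move=> qF; have := card_edge_faces (edge_of_face qF).
rewrite (cardsD1 F) inE subD1set => -[/eqP/cards1P[G DG]].
have: G \in [set G] by rewrite inE.
rewrite -DG !inE => /andP[GF FqG].
have FqI : val F :\ q \subset val F :&: val G by rewrite subsetI subD1set.
have Fq2 := card_faceD1 qF.
have nFG : ~~ (val F \subset val G).
  apply: contra GF => FG; rewrite eq_sym -val_eqE eqEcard FG.
  by rewrite !card_face.
have qG : q \notin val G.
  apply: contra nFG => qG; apply/subsetP=> r rF.
  by have [->|rq] := eqVneq r q; last by rewrite (subsetP FqG) ?inE ?rq.
exists G => //; rewrite adjE eqn_leq -[X in _ && (X <= _)]Fq2 subset_leq_card // andbT.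
rewrite -ltnS -(card_face F) proper_card // properE subsetIl.
by rewrite subsetI subxx.
Qed.

Lemma adj_setD F G q :
  e F G -> q \in val F -> q \notin val G -> val F :\: val G = [set q].
Proof.
move=> eFG qF qG; apply/setP=> r; rewrite !inE.
have [->|rq] := eqVneq r q; first by rewrite qF qG.
by apply/negP=> /andP[/negP rG rF]; apply: rG; apply: adj_in eFG qF _ _ _.
Qed.

(** Each neighbour is identified with its opposite vertex. Taking [Q] to be everything gives
    cubicity; a set of coloured vertices or its complement later counts the arcs of one colour at
    [F]. *)
Lemma card_neighbours F (Q : {set P}) :
  #|[set G | e F G & val F :\: val G \subset Q]| = #|val F :&: Q|.
Proof.
pose S := [set G | e F G & val F :\: val G \subset Q].
have inj : {in S &, injective (fun G : face X => val F :\: val G)}.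
  move=> G G'; rewrite !in_set => /andP[eFG _] /andP[eFG' _] E.
  have [q qF qG] := adj_opposite eFG; apply: (opposite_inj eFG eFG' qF qG).
  have: q \in val F :\: val G' by rewrite -E (adj_setD eFG qF qG) inE.
  by rewrite inE => /andP[].
rewrite -[RHS](card_imset _ set1_inj) -[LHS](card_in_imset inj).
apply: eq_card => A; apply/imsetP/imsetP=> [[G]|[q]]; rewrite in_set.
  case/andP=> eFG; have [q qF qG] := adj_opposite eFG.
  by rewrite (adj_setD eFG qF qG) sub1set => qQ ->; exists q; rewrite ?inE ?qF.
case/andP=> qF qQ ->; have [G eFG qG] := exists_opposite qF.
by exists G; rewrite ?in_set (adj_setD eFG qF qG) // eFG sub1set.
Qed.

Lemma face_graph_cubic : cubic e.
Proof.
move=> F; rewrite -(card_face F) -(setIT (val F)) -card_neighbours.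
by apply: eq_card => G; rewrite !inE subsetT andbT.
Qed.

(** The opposite vertices of three distinct neighbours in [star p] would be three vertices of [F]
    different from [p], making four in all. *)
Lemma star_degree p : degree_le2 e (star p).
Proof.
move=> F G1 G2 G3; rewrite !inE => pF p1 p2 p3 e1 e2 e3 n12 n13.
have [q1 q1F q1G] := adj_opposite e1; have [q2 q2F q2G] := adj_opposite e2.
have [q3 q3F q3G] := adj_opposite e3.
apply: (opposite_inj e2 e3 q2F q2G); suff -> : q2 = q3 by [].
apply/eqP/negPn/negP => n23.
have neq G G' q q' : e F G -> e F G' -> q \in val F -> q \notin val G ->
    q' \notin val G' -> G != G' -> q != q'.
  by move=> eG eG' qF qG q'G'; apply: contraNneq => E; subst q';
     apply/eqP; apply: opposite_inj eG eG' qF qG q'G'.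
have n1 := neq _ _ _ _ e1 e2 q1F q1G q2G n12.
have n3 := neq _ _ _ _ e1 e3 q1F q1G q3G n13.
have np q G : p \in val G -> q \notin val G -> p != q.
  by move=> pG; apply: contraNneq => <-.
have U : uniq [:: p; q1; q2; q3].
  rewrite /= !inE !negb_or n1 n3 n23.
  by rewrite (np _ _ p1 q1G) (np _ _ p2 q2G) (np _ _ p3 q3G).
have: [:: p; q1; q2; q3] \subset val F.
  by apply/subsetP=> q; rewrite !inE => /or4P[] /eqP->.
by move/subset_leq_card; rewrite card_face (card_uniqP U).
Qed.

Arguments star_degree : clear implicits.

Lemma face_other2 F p : p \in val F -> exists q r,
  [/\ q \in val F, r \in val F, q != p, r != p & q != r].
Proof.
move=> pF; have/eqP/cards2P[q [r [qr D]]] := card_faceD1 pF.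
have: q \in val F :\ p by rewrite D !inE eqxx.
have: r \in val F :\ p by rewrite D !inE eqxx orbT.
by rewrite !inE => /andP[rp rF] /andP[qp qF]; exists q, r.
Qed.

(** A face at [p] and its neighbours opposite its other two vertices all contain [p]. *)
Lemma card_star p : p \in vertices -> 2 < #|star p|.
Proof.
case/vertex_in_face=> F pF; have [q [r [qF rF qp rp qr]]] := face_other2 pF.
have [G eG qG] := exists_opposite qF; have [H eH rH] := exists_opposite rF.
suff <- : #|[set F; G; H]| = 3.
  apply/subset_leq_card/subsetP=> K; rewrite !inE => /orP[/orP[]|]/eqP-> //.
    by rewrite (adj_in eG qF qG) // eq_sym.
  by rewrite (adj_in eH rF rH) // eq_sym.
have neq K : e F K -> F != K by apply: contraTneq => <-; rewrite adj_irr.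
have nGH : G != H.
  by apply: contraNneq qG => ->; rewrite (adj_in eH rF rH).
by rewrite setUC cardsU1 !inE cards2 neq // negb_or ![H == _]eq_sym neq // nGH.
Qed.

(** * Vertex-defining cycles as Hamiltonian cycles of stars *)

Lemma umbrella_hamiltonian p (s : seq (face X)) :
  is_umbrella X [set p] (map val s) = hamiltonian e (star p) s.
Proof.
rewrite /is_umbrella /hamiltonian (map_inj_uniq val_inj); congr [&& _, _ & _].
  apply/forallP/forallP=> sP F.
    by have:= sP (val F); rewrite (mem_map val_inj) (valP F) sub1set inE.
  have [FX2|nFX2] := boolP (F \in simp X 2).
    have:= sP (Sub F FX2); rewrite -(mem_map val_inj) inE SubK.
    by rewrite sub1set.
  rewrite eqbF_neg /=; apply: contra nFX2 => /mapP[G _ ->]; exact: valP.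
by rewrite cycle_map; apply: eq_cycle => F G; rewrite adjE.
Qed.

Lemma star_hamiltonian p :
  p \in vertices -> exists s, hamiltonian e (star p) s.
Proof.
rewrite inE => pX; have [_ _ _ umbr _] := surfX.
have [|s us] := umbr [set p]; first by rewrite inE pX cards1.
have /all_sigP : all (mem (simp X 2)) s.
  apply/allP=> F Fs; have/and3P[_ /forallP/(_ F)/eqP sF _] := us.
  by move: Fs; rewrite sF => /andP[].
case=> t Dt; exists t; rewrite -umbrella_hamiltonian.
by move: us; rewrite Dt.
Qed.

Definition star_cycle p := ham_cyc e (star p).

(** Stars have degree at most two, so all umbrellas of a vertex give the same cycle. *)
Lemma vertex_defining_cyclesE :
  vertex_defining_cycles X = [set star_cycle p | p in vertices].
Proof.
apply/setP=> C; rewrite inE; apply/exists_inP/imsetP.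
  case=> v; rewrite inE => /andP[vX /cards1P[p Dp]].
  case/existsP=> s; rewrite Dp umbrella_hamiltonian => /andP[hs /eqP->].
  have pV : p \in vertices by rewrite inE -Dp.
  exists p => //.
  exact: (cyc_of_hamiltonian adj_sym (star_degree p) (card_star pV) hs).
case=> p pV ->; exists [set p]; first by rewrite inE cards1 andbT; rewrite inE in pV.
have [s hs] := star_hamiltonian pV; have [t Dt] := hamiltonian_bseq hs.
apply/existsP; exists t; rewrite umbrella_hamiltonian Dt hs.
by rewrite (cyc_of_hamiltonian adj_sym (star_degree p) (card_star pV) hs) eqxx.
Qed.

Lemma star_cycle_arcs p : p \in vertices ->
  cyc_arcs (star_cycle p) = [set A in arcs e | A \subset star p].
Proof.
move=> pV; have [s hs] := star_hamiltonian pV.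
exact: (cyc_arcs_ham adj_sym (star_degree p) (card_star pV) hs).
Qed.

Lemma star_cycle_nodes p :
  p \in vertices -> cyc_nodes (star_cycle p) = star p.
Proof. by case/star_hamiltonian=> s; apply: cyc_nodes_ham. Qed.

Lemma star_cycle_in_graph_cycles p :
  p \in vertices -> star_cycle p \in graph_cycles e.
Proof.
move=> pV; have [s hs] := star_hamiltonian pV.
exact: (ham_cyc_in_graph_cycles adj_sym (star_degree p) (card_star pV) hs).
Qed.

(** If a face at [p] also contains [q], its neighbour opposite [q] keeps [p] and avoids [q]. *)
Lemma separating_face p q : p \in vertices -> q != p ->
  exists2 F : face X, p \in val F & q \notin val F.
Proof.
case/vertex_in_face=> F pF qp; have [qF|qF] := boolP (q \in val F); last by exists F.
have [G eFG qG] := exists_opposite qF; exists G => //.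
by rewrite (adj_in eFG qF qG) // eq_sym.
Qed.

Lemma star_inj : {in vertices &, injective star}.
Proof.
move=> p q pV qV E; apply/eqP/negPn/negP=> pq.
rewrite eq_sym in pq; have [F pF qF] := separating_face pV pq.
by have:= in_set (fun F => p \in val F) F; rewrite -/(star p) E inE pF (negPf qF).
Qed.

Lemma star_cycle_inj : {in vertices &, injective star_cycle}.
Proof.
move=> p q pV qV E; apply: star_inj => //.
by rewrite -!star_cycle_nodes // E.
Qed.

Lemma arc_stars F G :
  e F G -> [set p | [set F; G] \subset star p] = val F :&: val G.
Proof. by move=> eFG; apply/setP=> p; rewrite inE subUset !sub1set !inE. Qed.

(** The cycles through an arc joining [F] and [G] belong to the points of [val F :&: val G], and
    there are two of those. *)
Lemma vertex_cycles_double_cover :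
  cycle_double_cover e (vertex_defining_cycles X).
Proof.
rewrite vertex_defining_cyclesE; split.
  by apply/subsetP=> _ /imsetP[p pV ->]; apply: star_cycle_in_graph_cycles.
move=> _ /(arcsP adj_sym)[F [G [eFG ->]]].
have:= eFG; rewrite adjE => /eqP <-; rewrite -(arc_stars eFG).
have sub : {subset [set p | [set F; G] \subset star p] <= vertices}.
  by move=> p; rewrite inE subUset !sub1set !inE => /andP[/face_vertex]; rewrite inE.
rewrite -(card_in_imset (f := star_cycle)); last first.
  by move=> p q /sub pV /sub qV; apply: star_cycle_inj.
apply: eq_card => C; rewrite inE; apply/andP/imsetP=> [[/imsetP[p pV ->]]|[p pS ->]].
  by rewrite star_cycle_arcs // inE => /andP[_ pFG]; exists p; rewrite ?inE.
have pV := sub p pS; rewrite imset_f // star_cycle_arcs // inE in_arcs ?eFG; last exact: adj_sym.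
by rewrite inE in pS.
Qed.

Lemma vertex_cycles_faithful : vertex_faithful e (vertex_defining_cycles X).
Proof.
rewrite vertex_defining_cyclesE; split.
  move=> _ /imsetP[p pV ->] A AE; rewrite star_cycle_nodes // star_cycle_arcs //.
  by rewrite inE AE.
move=> _ _ /imsetP[p pV ->] /imsetP[q qV ->] pq.
have {}pq : p != q by apply: contraNneq pq => ->.
(* A common arc consists of two faces containing both [p] and [q], hence of all faces over that
   edge: it can only be [S]. *)
rewrite !star_cycle_arcs //; pose S := [set F : face X | [set p; q] \subset val F].
suff {qV pV} arc_eq A : A \in arcs e -> A \subset star p -> A \subset star q -> A = S.
  apply/card_le1_eqP => A B /setIP[/setIdP[AE Ap] /setIdP[_ Aq]].
  case/setIP=> /setIdP[BE Bp] /setIdP[_ Bq].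
  by rewrite (arc_eq A AE Ap Aq) (arc_eq B BE Bp Bq).
case/(arcsP adj_sym)=> F [G [eFG ->]]; rewrite !subUset !sub1set !inE.
move=> /andP[pF pG] /andP[qF qG]; apply/eqP; rewrite eqEcard.
have nFG : F != G by apply: contraTneq eFG => ->; rewrite adj_irr.
rewrite cards2 nFG card_edge_faces ?andbT; last first.
  by rewrite inE cards2 pq andbT (sub_face (F := F)) // subUset !sub1set pF.
by rewrite !subUset !sub1set !inE !subUset !sub1set pF pG qF.
Qed.

(** * Automorphisms and their action on faces *)

Lemma aut_perm_on g : g \in surface_aut X -> perm_on vertices g.
Proof. by case/setIdP; rewrite inE. Qed.

Lemma aut_vertex g p :
  g \in surface_aut X -> (g p \in vertices) = (p \in vertices).
Proof. by move/aut_perm_on/perm_closed. Qed.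

Lemma mem_lambda g F p :
  g \in surface_aut X -> (g p \in val (lambda X g F)) = (p \in val F).
Proof. by move=> gA; rewrite lambdaE // mem_imset //; apply: perm_inj. Qed.

Lemma lambda_graph_aut g : g \in surface_aut X -> lambda X g \in graph_aut e.
Proof.
move=> gA; apply/graph_autP=> F G; rewrite !adjE !lambdaE //.
by rewrite -imsetI ?card_imset //; [apply: perm_inj | move=> p q _ _ /perm_inj].
Qed.

Lemma lambda_star g p :
  g \in surface_aut X -> [set lambda X g F | F in star p] = star (g p).
Proof.
move=> gA; apply/setP=> G; rewrite -(permKV (lambda X g) G).
by rewrite mem_imset; [rewrite !in_set mem_lambda | apply: perm_inj].
Qed.

Lemma act_star_cycle g p :
  g \in surface_aut X -> cyc_act (lambda X g) (star_cycle p) = star_cycle (g p).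
Proof.
by move=> gA; rewrite /star_cycle cyc_act_ham ?lambda_graph_aut // lambda_star.
Qed.

(** If [F] is fixed pointwise, each neighbour is preserved, because its opposite vertex is fixed,
    and then so is its single vertex outside [F]. Strong connectedness spreads this to all faces. *)
Lemma aut_fixing_face g F :
  g \in surface_aut X -> {in val F, forall p, g p = p} -> g = 1%g.
Proof.
move=> gA gF; have [_ _ _ _ connX] := surfX.
suff gfix G : {in val G, forall p, g p = p}.
  apply/permP=> p; rewrite perm1; have [pV|pV] := boolP (p \in vertices).
    by have [G pG] := vertex_in_face pV; apply: (gfix G).
  by rewrite (out_perm (aut_perm_on gA) pV).
have /connectP[s] := connX F G.
elim: s F gF => [|F1 s IHs] F gF /=; first by move=> _ ->.
case/andP=> eF ps lG; apply: (IHs F1) => // {ps lG IHs}.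
have [q qF qF1] := adj_opposite eF.
have lF : lambda X g F = F.
  apply: val_inj; rewrite lambdaE // -[RHS]imset_id.
  by apply: eq_in_imset => p pF; rewrite gF.
have lF1 : F1 = lambda X g F1.
  apply: (opposite_inj eF _ qF qF1).
    by rewrite -{1}lF; have /graph_autP-> := lambda_graph_aut gA.
  by rewrite -[q](gF _ qF) mem_lambda.
move=> r rF1; have [rF|rF] := boolP (r \in val F); first exact: gF.
have grF1 : g r \in val F1 by rewrite lF1 mem_lambda.
have [grF|grF] := boolP (g r \in val F); first exact/(@perm_inj _ g)/gF.
have: g r \in val F1 :\: val F by rewrite inE grF.
by rewrite (@adj_setD F1 F r) // 1?adj_sym // inE => /eqP.
Qed.

(** If [g p] and [h p] differed, some face would contain the first and avoid the second; its
    preimage under the common face permutation would both contain and avoid [p]. *)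
Lemma lambda_inj : {in surface_aut X &, injective (lambda X)}.
Proof.
move=> g h gA hA lgh; apply/permP=> p.
have [pV|pV] := boolP (p \in vertices); last first.
  by rewrite (out_perm (aut_perm_on gA) pV) (out_perm (aut_perm_on hA) pV).
apply/eqP/negPn/negP; rewrite eq_sym => ghp.
have gpV : g p \in vertices by rewrite aut_vertex.
have [F gpF] := separating_face gpV ghp.
move: gpF; rewrite -(permKV (lambda X g) F) mem_lambda // {2}lgh => pF.
by rewrite mem_lambda ?pF.
Qed.

Lemma lambdaM g h : g \in surface_aut X -> h \in surface_aut X ->
  lambda X (g * h) = (lambda X g * lambda X h)%g.
Proof.
move=> gA hA; apply/permP=> F; apply: val_inj; rewrite permM !lambdaE ?groupM //.
by rewrite -imset_comp; apply: eq_imset => p; rewrite permM.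
Qed.

Lemma lambda1 : lambda X 1 = 1%g.
Proof.
apply/permP=> F; apply: val_inj; rewrite perm1 lambdaE ?group1 //.
by rewrite -[RHS]imset_id; apply: eq_imset => p; rewrite perm1.
Qed.

Lemma lambdaX g n : g \in surface_aut X -> lambda X (g ^+ n) = (lambda X g ^+ n)%g.
Proof.
move=> gA; elim: n => [|n IHn]; first by rewrite !expg0 lambda1.
by rewrite !expgS lambdaM ?groupX // IHn.
Qed.

Lemma lambda_autE : lambda_aut X =i [set lambda X g | g in surface_aut X].
Proof.
move=> h; apply/lambda_autP/imsetP=> [] [g gA hE]; exists g => //.
  by apply/permP=> F; apply: val_inj; rewrite hE lambdaE.
by move=> F; rewrite hE lambdaE.
Qed.

Lemma mem_lambda_aut g : g \in surface_aut X -> lambda X g \in lambda_aut X.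
Proof. by move=> gA; rewrite lambda_autE imset_f. Qed.

Lemma card_lambda_aut : #|lambda_aut X| = #|surface_aut X|.
Proof.
by rewrite -(card_in_imset lambda_inj); apply/eq_card/lambda_autE.
Qed.

Lemma lambda_aut_sub : lambda_aut X \subset graph_aut e.
Proof.
apply/subsetP=> h; rewrite lambda_autE => /imsetP[g gA ->].
exact: lambda_graph_aut.
Qed.

Lemma card_faces : #|simp X 2| = #|face X|.
Proof. by rewrite card_sig; apply: eq_card. Qed.

Lemma face_transitiveP :
  face_transitive X <->
  forall F G, exists2 g, g \in surface_aut X & lambda X g F = G.
Proof.
split=> [tr F G|tr].
  have [g gA E] := atransP2 tr (valP F) (valP G).
  by exists g => //; apply: val_inj; rewrite lambdaE.
have [F0 _] := exists_face; apply/imsetP; exists (val F0); first exact: valP.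
apply/setP=> B; apply/idP/imsetP=> [BX|[g gA ->]].
  have [g gA E] := tr F0 (Sub B BX); exists g => //.
  by have:= congr1 val E; rewrite SubK lambdaE.
by have := valP (lambda X g F0); rewrite lambdaE.
Qed.

Lemma lambda_aut_transitiveP :
  face_transitive X <-> [transitive lambda_aut X, on [set: face X] | 'P].
Proof.
split=> [/face_transitiveP tr|tr]; last apply/face_transitiveP=> F G.
  have [F0 _] := exists_face; apply/imsetP; exists F0; rewrite ?inE //.
  apply/setP=> F; rewrite inE; symmetry; apply/imsetP.
  by have [g gA <-] := tr F0 F; exists (lambda X g); rewrite ?mem_lambda_aut.
have [h] := atransP2 tr (in_setT F) (in_setT G).
rewrite lambda_autE => /imsetP[g gA ->] ->.
by exists g.
Qed.

(** Orbit-stabiliser formula; it translates between the order of a face stabiliser and that of the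
    whole group. *)
Lemma card_face_stabilizer F : face_transitive X ->
  #|face X| * #|'C_(surface_aut X)[val F | 'P^*]%g| = #|surface_aut X|.
Proof.
move=> tr; rewrite -card_faces -(card_orbit_stab 'P^* (surface_aut_group X) (val F)).
by rewrite (atransP tr) // (valP F).
Qed.

Lemma vfE : exists F,
  vf X = (#|orbit 'P (surface_aut X) @: vertices|,
          #|'C_(surface_aut X)[val F | 'P^*]%g|).
Proof.
rewrite /vf; case: pickP => [B BX|noF]; last first.
  by have [F0 _] := exists_face; have:= noF (val F0); rewrite (valP F0).
exists (Sub B BX); rewrite SubK /=; congr (_, _).
have -> : simp X 0 = set1 @: vertices.
  apply/setP=> v; rewrite inE; apply/andP/imsetP=> [[vX /cards1P[p vE]]|[p]].
    by exists p => //; rewrite inE -vE.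
  by rewrite inE => pX ->; rewrite cards1.
rewrite -imset_comp.
have orb p : orbit 'P^* (surface_aut X) [set p] = set1 @: orbit 'P (surface_aut X) p.
  rewrite /orbit -imset_comp; apply: eq_imset => g /=.
  by rewrite /setact imset_set1.
(* [lift] carries orbits of points injectively to orbits of singletons, so their numbers agree. *)
pose lift (A : {set P}) := [set [set p] | p in A].
rewrite (eq_imset (g := lift \o orbit 'P (surface_aut X)) _ orb).
by rewrite imset_comp card_imset //; apply: imset_inj set1_inj.
Qed.

Lemma face_graph_simple_connected : simple_connected_graph e.
Proof.
split; [exact: adj_sym|exact: adj_irr|by case: surfX].
Qed.

(** * Arcs under automorphisms, and the type obtained from the cover *)

Lemma lambda_arc g A :
  g \in surface_aut X -> A \in arcs e -> [set lambda X g F | F in A] \in arcs e.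
Proof.
move=> gA /(arcsP adj_sym)[F [G [eFG ->]]].
rewrite imsetU !imset_set1 (in_arcs adj_sym).
by have /graph_autP-> := lambda_graph_aut gA.
Qed.

Lemma arc_in_star A : A \in arcs e ->
  exists2 p, p \in vertices & A \subset star p.
Proof.
case/(arcsP adj_sym)=> F [G [eFG ->]].
have [p] : exists p, p \in val F :&: val G.
  by apply/card_gt0P; have:= eFG; rewrite adjE => /eqP->.
rewrite inE => /andP[pF pG]; exists p; first exact: face_vertex pF.
by rewrite subUset !sub1set !in_set pF.
Qed.

Lemma orbit_lambda_aut A B : B \in orbit 'P^* (lambda_aut X) A ->
  exists2 g, g \in surface_aut X & B = [set lambda X g F | F in A].
Proof.
case/imsetP=> h; rewrite lambda_autE => /imsetP[g gA ->] ->.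
by exists g.
Qed.

Lemma orbit_lambda g (A : {set face X}) : g \in surface_aut X ->
  [set lambda X g F | F in A] \in orbit 'P^* (lambda_aut X) A.
Proof. by move=> gA; apply/imsetP; exists (lambda X g); rewrite ?mem_lambda_aut. Qed.

Lemma cover22_vf :
    group22 e (lambda_aut X) ->
    is_C22 e (lambda_aut X) (vertex_defining_cycles X) ->
  face_transitive X /\ vf X = (2, 2).
Proof.
case=> _ _ [/lambda_aut_transitiveP tr cardH] _.
move=> [E1 [E2 [[orbE E12 _ _]]]] [Fm [F1 [F2 [s [u [_ _ [_ mono_u] coverE _]]]]]].
split=> //; have [F ->] := vfE; congr (_, _); last first.
  have := card_face_stabilizer F tr; rewrite -card_lambda_aut cardH mulnC.
  by move/eqP; rewrite eqn_pmul2r => [/eqP//|]; apply/card_gt0P; exists F.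
rewrite vertex_defining_cyclesE in coverE.
have cyc_orbit_refl C : C \in cyc_orbit (lambda_aut X) C.
  by apply/imsetP; exists 1%g; rewrite ?group1 ?cyc_act1.
have in_cover C : C \in cyc_orbit (lambda_aut X) u
    \/ C \in cyc_orbit (lambda_aut X) (cyc_of (alpha s [:: Fm; F1; F2])) ->
    exists2 p, p \in vertices & C = star_cycle p.
  by move=> CE; apply/imsetP; rewrite coverE inE; apply/orP.
(* Each orbit contains its generating cycle, so both generating cycles are cycles of vertices, and
   these two vertices represent all vertex orbits. *)
have [a aV uE] := in_cover u (or_introl (cyc_orbit_refl u)).
have [b bV alphaE] := in_cover _ (or_intror (cyc_orbit_refl _)).
have same_orbit p q : p \in vertices -> q \in vertices ->
    star_cycle q \in cyc_orbit (lambda_aut X) (star_cycle p) ->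
    q \in orbit 'P (surface_aut X) p.
  move=> pV qV /imsetP[h]; rewrite lambda_autE => /imsetP[g gA ->].
  rewrite act_star_cycle // => /star_cycle_inj-> //; last by rewrite aut_vertex.
  by apply/imsetP; exists g.
have vertex_orbit p : p \in vertices ->
    p \in orbit 'P (surface_aut X) a \/ p \in orbit 'P (surface_aut X) b.
  move=> pV; have := imset_f star_cycle pV; rewrite coverE inE alphaE uE.
  by case/orP=> /same_orbit; [left | right]; auto.
suff ab : b \notin orbit 'P (surface_aut X) a.
  suff -> : orbit 'P (surface_aut X) @: vertices
    = [set orbit 'P (surface_aut X) a; orbit 'P (surface_aut X) b].
    rewrite cards2; case: eqP => // ab'; case/negP: ab.
    by rewrite ab' orbit_refl.
  apply/setP=> O; apply/imsetP/set2P=> [[p pV ->]|[]->]; last 2 first.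
  - by exists a.
  - by exists b.
  by case: (vertex_orbit p pV) => /orbit_eqP; [left | right].
(* With a single orbit, every arc lies in the star of a translate of [a]; moving it into [star a]
   shows that it has the colour of [u], so both colours coincide. *)
apply/negP=> ab.
have all_a p : p \in vertices -> p \in orbit 'P (surface_aut X) a.
  by case/vertex_orbit=> // /orbit_trans; apply.
have E_sub E : E \in orbit 'P^* (lambda_aut X) @: arcs e ->
    cyc_arcs u \subset E -> forall A, A \in arcs e -> A \in E.
  case/imsetP=> B _ ->; rewrite uE star_cycle_arcs // => /subsetP sub A AE.
  have [p pV Ap] := arc_in_star AE.
  have [g gA pE] : exists2 g, g \in surface_aut X & g p = a.
    have := all_a p pV; rewrite orbit_sym => /imsetP[g gA ->].
    by exists g.
  apply: orbit_trans (sub [set lambda X g F' | F' in A] _).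
    by rewrite orbit_sym orbit_lambda.
  by apply/setIdP; rewrite lambda_arc // -pE -lambda_star // imsetS.
have E_eq E E' : E \in orbit 'P^* (lambda_aut X) @: arcs e ->
    E' \in orbit 'P^* (lambda_aut X) @: arcs e -> cyc_arcs u \subset E -> E = E'.
  move=> orbE0 /imsetP[A AE ->] sub; have := E_sub E orbE0 sub A AE.
  by case/imsetP: orbE0 => B _ -> /orbit_eqP.
case/eqP: E12; have O1 := set21 E1 E2; have O2 := set22 E1 E2.
rewrite -orbE in O1 O2.
by case/orP: mono_u => ?; [apply: E_eq | symmetry; apply: E_eq].
Qed.

(** * Vertex colourings *)

(** A flag is a pair of a face and one of its vertices; its colour tells whether the vertex is in
    [A]. The arc colouring and the cover are built using only these consequences of the type. *)
Definition flag_colouring (A : {set P}) : Prop :=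
  [/\ forall g p, g \in surface_aut X -> (g p \in A) = (p \in A),
      forall F, #|val F :&: A| = 1
    & forall F G p q, p \in val F -> q \in val G -> (p \in A) = (q \in A) ->
      exists g, [/\ g \in surface_aut X, lambda X g F = G & g p = q]].

Lemma vf22_flag_colouring :
  face_transitive X -> vf X = (2, 2) -> exists A, flag_colouring A.
Proof.
move=> tr; have /face_transitiveP autT := tr.
have [F0 ->] := vfE => -[orbits2 stab2].
have [g /setIP[gA gF] g1] : exists2 g,
    g \in 'C_(surface_aut X)[val F0 | 'P^*]%g & g != 1%g.
  by apply/trivgPn; rewrite trivg_card1 stab2.
have g2 : (g * g = 1)%g.
  have g_stab : g \in 'C_(surface_aut X)[val F0 | 'P^*]%g by rewrite inE gA.
  by rewrite -expg2 -stab2 expg_cardG.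
have lF0 : lambda X g F0 = F0.
  by apply: val_inj; rewrite lambdaE //; apply/astab1P: gF.
have gE p : (g p \in val F0) = (p \in val F0) by rewrite -{1}lF0 mem_lambda.
(* An automorphism fixing all vertices of [F0] is trivial, so the involution [g] moves some [b]; [a]
   will be the vertex of [F0] other than [b] and [g b]. *)
have [b bF gb] : exists2 b, b \in val F0 & g b != b.
  apply/exists_inP; apply: contraNT g1 => /exists_inPn gfix.
  by apply/eqP/(aut_fixing_face gA (F := F0)) => p /gfix/negbNE/eqP.
have gc : g (g b) = b by rewrite -permM g2 perm1.
have [a DF] : exists a, (val F0 :\ b) :\ g b = [set a].
  by apply/cards1P; have:= card_faceD1 bF; rewrite (cardsD1 (g b)) !inE gb gE bF => -[/eqP].
have /and3P[agb ab aF] : [&& a != g b, a != b & a \in val F0].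
  by have:= set11 a; rewrite -DF !inE.
have F0E p : p \in val F0 -> [\/ p = a, p = b | p = g b].
  move=> pF; have [->|pb] := eqVneq p b; first by constructor 2.
  have [->|pgb] := eqVneq p (g b); first by constructor 3.
  by constructor 1; apply/set1P; rewrite -DF !inE pgb pb.
pose A := orbit 'P (surface_aut X) a.
have AE h p : h \in surface_aut X -> (h p \in A) = (p \in A).
  by move=> hA; apply: orbit_actr.
(* Every flag is the image of a flag at [F0]; the one at [g b] is replaced by that at [b] by
   applying [g] first. *)
have from_F0 F p : p \in val F ->
    exists2 h, h \in surface_aut X /\ lambda X h F0 = F & h a = p \/ h b = p.
  move=> pF; have [h hA hF] := autT F0 F; subst F.
  move: pF; rewrite -{1}(permKV h p) mem_lambda // => /F0E[] E.
  - by exists h; rewrite // -E permKV; left.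
  - by exists h; rewrite // -E permKV; right.
  exists (g * h)%g; first by rewrite lambdaM // permM lF0 groupM.
  by right; rewrite permM -E permKV.
(* Otherwise all vertices would form a single orbit, whereas [vf X] counts two. *)
have bA : b \notin A.
  apply/negP=> bA; have: orbit 'P (surface_aut X) @: vertices = [set A].
    apply/eqP; rewrite eqEsubset sub1set; apply/andP; split; last first.
      by apply: imset_f; apply: face_vertex aF.
    apply/subsetP=> _ /imsetP[p pV ->]; rewrite inE.
    have [F pF] := vertex_in_face pV; have [h [hA _] hp] := from_F0 F p pF.
    apply/eqP/orbit_eqP; case: hp => <-; rewrite -/A AE //; exact: orbit_refl.
  by move=> orbE; rewrite orbE cards1 in orbits2.
have from_F0' F p : p \in val F -> exists h,
    [/\ h \in surface_aut X, lambda X h F0 = F & h (if p \in A then a else b) = p].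
  move=> pF; have [h [hA hF] hp] := from_F0 F p pF; exists h; split=> //.
  by case: hp => <-; rewrite AE // ?(negPf bA) // orbit_refl.
exists A; split=> // [F|F G p q pF qG pq].
  have [h hA <-] := autT F0 F; apply/eqP/cards1P; exists (h a); apply/setP=> p.
  rewrite -(permKV h p) !inE mem_lambda // AE // (inj_eq perm_inj).
  apply/andP/eqP=> [[/F0E[]-> //]|->]; last by rewrite aF orbit_refl.
    by rewrite (negPf bA).
  by rewrite AE // (negPf bA).
have [h [hA hF hp]] := from_F0' F p pF; have [k [kA kG kq]] := from_F0' G q qG.
(* Go back to [F0] along [h], then to [G] along [k]; equal colours mean that both flags come from
   the same vertex of [F0]. *)
exists (h^-1 * k)%g; split; first by rewrite groupM ?groupV.
  rewrite lambdaM ?groupV // permM -hF -[lambda X _ (lambda X h _)]permM.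
  by rewrite -lambdaM ?groupV // mulgV lambda1 perm1.
by rewrite permM -hp permK pq kq.
Qed.

Section FlagColouring.

Variable A : {set P}.
Hypothesis colA : flag_colouring A.

(** * Colours of vertices and arcs *)

Lemma colour_aut g p : g \in surface_aut X -> (g p \in A) = (p \in A).
Proof. by case: colA => + _ _; apply. Qed.

Lemma colour_unique F p q :
  p \in val F -> q \in val F -> p \in A -> q \in A -> p = q.
Proof.
move=> pF qF pA qA; have [_ /(_ F) FA1 _] := colA.
by have /card_le1_eqP := eq_leq FA1; apply; rewrite inE ?pF ?qF.
Qed.

Lemma card_uncoloured F : #|val F :&: ~: A| = 2.
Proof.
have [_ /(_ F) FA1 _] := colA; have := cardsID A (val F).
by rewrite FA1 card_face setDE => -[].
Qed.

Lemma uncoloured_unique F b p q : b \in val F -> b \notin A ->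
    p \in val F -> p \notin A -> p != b -> q \in val F -> q \notin A -> q != b ->
  p = q.
Proof.
move=> bF bA pF pA pb qF qA qb; have := card_uncoloured F.
rewrite (cardsD1 b) !inE bF bA => -[] /eq_leq/card_le1_eqP; apply.
  by rewrite !inE qb qF.
by rewrite !inE pb pF.
Qed.

Lemma coloured_vertex F : exists2 a, a \in val F & a \in A.
Proof.
have [_ /(_ F) FA1 _] := colA; have /card_gt0P[a] : 0 < #|val F :&: A| by rewrite FA1.
by rewrite inE => /andP[aF aA]; exists a.
Qed.

(** The only coloured vertex of [F] is fixed because colours are preserved; of the two uncoloured
    ones, fixing [b] forces the other to be fixed too. *)
Lemma aut_fixing_flag h F b : h \in surface_aut X -> lambda X h F = F ->
  b \in val F -> b \notin A -> h b = b -> h = 1%g.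
Proof.
move=> hA hF bF bA hb; apply: (aut_fixing_face hA (F := F)) => p pF.
have hpF : h p \in val F by rewrite -hF mem_lambda.
have [pA|pA] := boolP (p \in A).
  by apply: (colour_unique hpF pF); rewrite ?colour_aut.
have [->//|pb] := eqVneq p b.
apply: (uncoloured_unique bF bA hpF _ _ pF pA pb); first by rewrite colour_aut.
by rewrite -hb (inj_eq perm_inj).
Qed.

(** These arcs will form [E1]: they are the ones traversed by the cycles around the vertices in
    [A]. *)
Definition coloured_arcs : {set {set face X}} :=
  [set B in arcs e | [exists p in A, B \subset star p]].

(** [G] misses only [q] among the vertices of [F], so the unique coloured vertex of [F] lies in [G]
    exactly when it is not [q]. *)
Lemma coloured_arcE F G q : e F G -> q \in val F -> q \notin val G ->
  ([set F; G] \in coloured_arcs) = (q \notin A).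
Proof.
move=> eFG qF qG; rewrite in_set (in_arcs adj_sym) eFG /=.
apply/exists_inP/idP=> [[p pA]|qA].
  rewrite subUset !sub1set !in_set => /andP[pF pG].
  by apply: contra qG => qA; rewrite (colour_unique qF pF).
have [a aF aA] := coloured_vertex F; exists a => //.
rewrite subUset !sub1set !in_set aF (adj_in eFG qF qG) //.
by apply: contraTneq aA => ->.
Qed.

(** Automorphisms preserve the colour. Conversely, an arc at [F] is determined by the flag of [F]
    and the opposite vertex, and flags of equal colour are equivalent. *)
Lemma coloured_arc_orbit B C : B \in arcs e ->
  (C \in orbit 'P^* (lambda_aut X) B)
    = (C \in arcs e) && ((C \in coloured_arcs) == (B \in coloured_arcs)).
Proof.
have inv g D : g \in surface_aut X -> D \in coloured_arcs ->
    [set lambda X g F | F in D] \in coloured_arcs.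
  move=> gA /setIdP[DE /exists_inP[p pA Dp]]; apply/setIdP.
  split; first exact: lambda_arc.
  apply/exists_inP; exists (g p); first by rewrite colour_aut.
  by rewrite -lambda_star // imsetS.
have invV C' B' : C' \in orbit 'P^* (lambda_aut X) B' ->
    B' \in coloured_arcs -> C' \in coloured_arcs.
  by case/orbit_lambda_aut=> g gA ->; apply: inv.
move=> BE; apply/idP/andP=> [CB|[]].
  split; first by have [g gA ->] := orbit_lambda_aut CB; apply: lambda_arc.
  apply/eqP; apply/idP/idP; apply: invV => //.
  by rewrite orbit_sym.
have /(arcsP adj_sym)[F [G [eFG ->]]] := BE.
case/(arcsP adj_sym)=> F' [G' [eFG' ->]].
have [q qF qG] := adj_opposite eFG; have [q' qF' qG'] := adj_opposite eFG'.
rewrite (coloured_arcE eFG qF qG) (coloured_arcE eFG' qF' qG').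
rewrite (inj_eq negb_inj) => /eqP qq'; have [_ _ flagT] := colA.
have [g [gA gF gq]] := flagT F F' q q' qF qF' (esym qq').
suff <- : [set lambda X g H | H in [set F; G]] = [set F'; G'].
  exact: orbit_lambda.
rewrite imsetU !imset_set1 gF; congr [set _; _].
apply: (opposite_inj _ eFG' qF') => //.
  by rewrite -gF; have /graph_autP-> := lambda_graph_aut gA.
by rewrite -gq mem_lambda.
Qed.

Definition uncoloured_arcs := arcs e :\: coloured_arcs.

(** Sending [G] to the arc from [F] to [G] reduces the count to [card_neighbours]; [Q] tells which
    opposite vertices give arcs of [E]. *)
Lemma card_arcs_at F (E : {set {set face X}}) (Q : {set P}) :
    E \subset arcs e ->
    (forall G, e F G -> ([set F; G] \in E) = (val F :\: val G \subset Q)) ->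
  #|[set B in E | F \in B]| = #|val F :&: Q|.
Proof.
move=> /subsetP EE EP; rewrite -card_neighbours.
have inj : {in [set G | e F G & val F :\: val G \subset Q] &,
    injective (fun G => [set F; G])}.
  move=> G G'; rewrite !in_set => /andP[eFG _] _ E'.
  have: G \in [set F; G'] by rewrite -E' set22.
  by case/set2P=> // GF; rewrite GF adj_irr in eFG.
rewrite -[RHS](card_in_imset inj); apply: eq_card => B.
apply/setIdP/imsetP=> [[BE]|[G]].
  case/(arcsP adj_sym): (EE B BE) => G [G' [eG BD]]; subst B.
  case/set2P=> ?; subst; [exists G' | exists G; last by rewrite setUC] => //.
    by rewrite in_set eG -EP.
  by rewrite in_set adj_sym eG -EP ?(adj_sym G') // setUC.
by rewrite in_set => /andP[eFG FG] ->; rewrite EP // set21.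
Qed.

Lemma flag_colouring_orbits : arc_orbits22 e (lambda_aut X) coloured_arcs uncoloured_arcs.
Proof.
(* The neighbours opposite a coloured and an uncoloured vertex of one face provide an arc of either
   colour, so neither class is empty. *)
have [F0 _] := exists_face; have [a aF aA] := coloured_vertex F0.
have [b [c [bF _ ba _ _]]] := face_other2 aF.
have bA : b \notin A.
  by apply: contra ba => bA; apply/eqP; apply: colour_unique bF aF bA aA.
have [G eG aG] := exists_opposite aF; have [G' eG' bG'] := exists_opposite bF.
have G_un : [set F0; G] \in uncoloured_arcs.
  by apply/setDP; rewrite (in_arcs adj_sym) (coloured_arcE eG aF aG) aA.
have G'_col : [set F0; G'] \in coloured_arcs by rewrite (coloured_arcE eG' bF bG').
have col_arc B : B \in coloured_arcs -> B \in arcs e by case/setIdP.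
have orbE B : B \in arcs e -> orbit 'P^* (lambda_aut X) B
    = if B \in coloured_arcs then coloured_arcs else uncoloured_arcs.
  move=> BE; apply/setP=> C; rewrite coloured_arc_orbit //.
  case: ifP => _; last by rewrite in_setD andbC eqbF_neg.
  by rewrite eqb_id andbC; apply/andP/idP=> [[]|/[dup]/col_arc].
have arc2 B : B \in arcs e -> #|B| = 2.
  case/(arcsP adj_sym)=> F [H [eFH ->]]; rewrite cards2.
  by case: eqP eFH => // ->; rewrite adj_irr.
split.
- apply/setP=> O; apply/imsetP/set2P=> [[B BE ->]|[]->].
  + by rewrite orbE //; case: ifP; [left | right].
  + by exists [set F0; G']; rewrite ?orbE ?col_arc // G'_col.
  exists [set F0; G]; first by case/setDP: G_un.
  by rewrite orbE; case/setDP: G_un => // _ /negPf->.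
- by apply/eqP=> E12; case/setDP: (G_un) => _; rewrite E12 G_un.
(* Every arc has two nodes; every face lies on two coloured arcs, opposite its uncoloured vertices,
   and on one uncoloured arc. *)
- apply/eqP; rewrite -(eqn_pmul2l (isT : 0 < 2)).
  rewrite (card_uniform_cover (d := 2) (k := 2)) // => [B /col_arc/arc2 //|F].
  rewrite (card_arcs_at (Q := ~: A)) ?card_uncoloured //.
    by apply/subsetP=> B /col_arc.
  move=> H eFH; have [q qF qH] := adj_opposite eFH.
  by rewrite (coloured_arcE eFH qF qH) (adj_setD eFH qF qH) sub1set inE.
rewrite (card_uniform_cover (d := 2) (k := 1)) ?mul1n // => [B /setDP[/arc2]|F] //.
have [_ /(_ F) FA1 _] := colA; rewrite -[RHS]FA1.
apply: card_arcs_at; first exact: subsetDl.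
move=> H eFH; have [q qF qH] := adj_opposite eFH.
rewrite in_setD (in_arcs adj_sym) (coloured_arcE eFH qF qH) eFH andbT negbK.
by rewrite (adj_setD eFH qF qH) sub1set.
Qed.

(** An uncoloured arc at [F] is opposite the only coloured vertex of [F]: the uncoloured arcs form a
    matching. *)
Lemma uncoloured_nbr_unique F G G' : e F G -> e F G' ->
    [set F; G] \notin coloured_arcs -> [set F; G'] \notin coloured_arcs ->
  G = G'.
Proof.
move=> eG eG'; have [q qF qG] := adj_opposite eG.
have [q' qF' qG'] := adj_opposite eG'.
rewrite (coloured_arcE eG qF qG) (coloured_arcE eG' qF' qG') !negbK => qA qA'.
apply: (opposite_inj eG eG' qF qG).
by rewrite (colour_unique qF qF' qA qA').
Qed.

(** Inside the star of [b], the vertex opposite a coloured arc is the uncoloured vertex of [F] other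
    than [b]. Together with the matching, this makes the colours alternate around [b]. *)
Lemma coloured_nbr_unique b F G G' : b \notin A -> e F G -> e F G' ->
    b \in val F -> b \in val G -> b \in val G' ->
    [set F; G] \in coloured_arcs -> [set F; G'] \in coloured_arcs ->
  G = G'.
Proof.
move=> bA eG eG' bF bG bG'; have [q qF qG] := adj_opposite eG.
have [q' qF' qG'] := adj_opposite eG'.
rewrite (coloured_arcE eG qF qG) (coloured_arcE eG' qF' qG') => qA qA'.
apply: (opposite_inj eG eG' qF qG).
have -> // : q = q'.
apply: (uncoloured_unique bF bA) => //.
  by apply: contraNneq qG => ->.
by apply: contraNneq qG' => ->.
Qed.

Lemma lambda_coloured g B : g \in surface_aut X -> B \in arcs e ->
  ([set lambda X g F | F in B] \in coloured_arcs) = (B \in coloured_arcs).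
Proof.
move=> gA BE; have := orbit_lambda B gA.
by rewrite coloured_arc_orbit // => /andP[_ /eqP].
Qed.

(** * The alpha-cycle around an uncoloured vertex *)

Section AlphaCycle.

Variables (b : P) (Fm F1 F2 : face X) (g : {perm P}).
Hypotheses (bA : b \notin A) (gA : g \in surface_aut X) (gb : g b = b).
Hypotheses (bFm : b \in val Fm) (bF1 : b \in val F1).
Hypotheses (eFm1 : e Fm F1) (e12 : e F1 F2) (gFm : lambda X g Fm = F2).
Hypotheses (un_m1 : [set Fm; F1] \notin coloured_arcs).
Hypotheses (col_12 : [set F1; F2] \in coloured_arcs).

Let s := lambda X g.
(** The alpha-cycle visits [x 1], [y 1], [x 2], [y 2] and so on; arcs from [x i] to [y i] are
    uncoloured, those from [y i] to [x i.+1] coloured. *)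
Let x i := (s ^+ i)%g Fm.
Let y i := (s ^+ i)%g F1.

Lemma alpha_fix i : (g ^+ i)%g b = b.
Proof. by elim: i => [|i IHi]; rewrite ?expg0 ?perm1 // expgSr permM IHi. Qed.

Lemma alpha_mem F i : b \in val F -> b \in val ((s ^+ i)%g F).
Proof. by move=> bF; rewrite -lambdaX // -{1}(alpha_fix i) mem_lambda ?groupX. Qed.

Lemma alpha_next i : x i.+1 = (s ^+ i)%g F2.
Proof. by rewrite /x expgS permM gFm. Qed.

Lemma alpha_adj F G i : e ((s ^+ i)%g F) ((s ^+ i)%g G) = e F G.
Proof.
by rewrite -lambdaX //; have /graph_autP-> := lambda_graph_aut (groupX i gA).
Qed.

Lemma alpha_colour F G i : e F G ->
  ([set (s ^+ i)%g F; (s ^+ i)%g G] \in coloured_arcs) = ([set F; G] \in coloured_arcs).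
Proof.
move=> eFG; rewrite -lambdaX // -[RHS](lambda_coloured (groupX i gA)).
  by rewrite imsetU !imset_set1.
by rewrite (in_arcs adj_sym).
Qed.

(** The unique uncoloured neighbour of [x i] is [y i], that of [y j] is [x j]. *)
Lemma alpha_xy_swap i j : x i = y j -> y i = x j.
Proof.
move=> xy; apply: (@uncoloured_nbr_unique (x i)); rewrite ?alpha_colour ?alpha_adj //.
  by rewrite xy adj_sym alpha_adj.
by rewrite xy setUC alpha_colour.
Qed.

(** Likewise for the unique coloured neighbour within [star b]: that of [y i] is [x i.+1], that of
    [x j.+1] is [y j]. *)
Lemma alpha_yx_swap i j : y i = x j.+1 -> x i.+1 = y j.
Proof.
rewrite !alpha_next => yx.
apply: (@coloured_nbr_unique b (y i)); rewrite ?alpha_colour ?alpha_adj //.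
- by rewrite yx adj_sym alpha_adj.
- exact: alpha_mem.
- by rewrite -alpha_next; apply: alpha_mem.
- exact: alpha_mem.
by rewrite yx setUC alpha_colour.
Qed.

(* Reflecting the coincidence [x i = y j] in the arcs of either colour gives
   [x i.+1 = y j.-1]; in the end an arc would be a loop. *)
Lemma alpha_x_neq_y i j : x i <> y j.
Proof.
have loop k : x k <> y k.
  by move=> xy; have := alpha_adj Fm F1 k; rewrite -/(x k) xy adj_irr eFm1.
have loop' k : y k <> x k.+1.
  by move=> yx; have := alpha_adj F1 F2 k; rewrite -/(y k) yx alpha_next adj_irr e12.
have shift d k : x k <> y (k + d).
  elim/ltn_ind: d k => -[|[|d]] IHd k; rewrite ?addn0 //.
    by rewrite addn1 => /alpha_xy_swap; apply: loop'.
  rewrite !addnS => /alpha_xy_swap/alpha_yx_swap; rewrite -addSn.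
  exact: IHd.
have [/subnKC <-|/ltnW/subnKC ij] := leqP i j; first exact: shift.
by move/alpha_xy_swap/esym; rewrite -ij; apply: shift.
Qed.

(** The automorphism [g ^+ i * (g ^+ j)^-1] fixes [F] and its uncoloured vertex [b], so it is
    trivial. *)
Lemma alpha_inj F i j : b \in val F -> (s ^+ i)%g F = (s ^+ j)%g F ->
  (s ^+ i = s ^+ j)%g.
Proof.
move=> bF ij; have gi := groupX i gA; have gj := groupX j gA.
have: (g ^+ i * (g ^+ j)^-1 = 1)%g.
  apply: (@aut_fixing_flag _ F b) => //.
  - by rewrite groupM ?groupV.
  - rewrite lambdaM ?groupV // permM lambdaX // ij -lambdaX // -permM.
    by rewrite -lambdaM ?groupV // mulgV lambda1 perm1.
  by rewrite permM alpha_fix -{1}(alpha_fix j) permK.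
by move/eqP; rewrite -eq_mulgV1 => /eqP E; rewrite -!lambdaX // E.
Qed.

Let n := #[s]%g.
Let t := flatten [seq map (s ^+ i)%g [:: Fm; F1] | i <- iota 1 n].

Lemma alpha_uniq : uniq t.
Proof.
(* Exponents run from 1 to [n]; lowering both by one puts them below the order of [s]. *)
have eqij i j : i \in iota 1 n -> j \in iota 1 n -> (s ^+ i = s ^+ j)%g -> i = j.
  rewrite !mem_iota !add1n; case: i j => [|i] [|j] //= in_ jn.
  rewrite !expgS => /mulgI/eqP; rewrite eq_expg_mod_order !modn_small //.
  by move/eqP->.
apply: (@allpairs_uniq _ _ _ (fun i => (s ^+ i)%g : _ -> _)).
- exact: iota_uniq.
- by rewrite /= inE andbT; apply: contraTneq eFm1 => ->; rewrite adj_irr.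
move=> _ _ /allpairsP[[i F] [iI FI ->]] /allpairsP[[j G] [jI GI ->]].
rewrite /= in iI FI jI GI *.
rewrite !inE in FI GI; case/orP: FI => /eqP->; case/orP: GI => /eqP-> E.
- by rewrite (eqij i j) //; apply: alpha_inj bFm E.
- by case: (@alpha_x_neq_y i j).
- by case: (@alpha_x_neq_y j i).
by rewrite (eqij i j) //; apply: alpha_inj bF1 E.
Qed.

(** Exponents start at [k.+1], so the node before the path is [y k]. For [k = 0] and [m = n] the
    path ends in [y n = y 0], which closes the cycle. *)
Lemma alpha_path k m :
  let p := flatten [seq map (s ^+ i)%g [:: Fm; F1] | i <- iota k.+1 m] in
  path e (y k) p /\ last (y k) p = y (k + m).
Proof.
elim: m k => [|m IHm] k /=; first by rewrite addn0.
have [pk lk] := IHm k.+1; rewrite -/(x k.+1) -/(y k.+1) pk lk addSnnS.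
by rewrite alpha_next alpha_adj e12 -alpha_next alpha_adj eFm1.
Qed.

Lemma size_alpha : size t = 2 * n.
Proof.
by rewrite (size_allpairs (fun i => (s ^+ i)%g : _ -> _)) size_iota mulnC.
Qed.

Lemma alphaE : alpha s [:: Fm; F1; F2] = t.
Proof.
rewrite /alpha /= -/t; case: eqP => // -[].
rewrite -/n -size_alpha -(card_uniqP alpha_uniq); apply: eq_card => F.
apply/imset2P/flatten_mapP=> [[i G _ GI ->]|[i]].
  have GI' : G \in [:: Fm; F1] by [].
  (* [alpha_nodes] uses the exponents from 0 to [n - 1], the sequence those from 1 to [n]; exponent
     0 is replaced by [n]. *)
  have [i0|i_gt0] := posnP i.
    exists n; first by rewrite mem_iota order_gt0 add1n leqnn.
    by rewrite expg_order -(expg0 s) -i0 map_f.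
  by exists (i : nat); rewrite ?map_f // mem_iota i_gt0 add1n ltnS ltnW.
rewrite mem_iota => _ /mapP[G GI ->].
have i_lt : i %% n < n by rewrite ltn_mod order_gt0.
by exists (Ordinal i_lt) G => //=; rewrite expg_mod_order.
Qed.

(** A cycle inside [star b] with more than two nodes covers the whole star, by [cycle_exhausts]. *)
Lemma alpha_hamiltonian : hamiltonian e (star b) (alpha s [:: Fm; F1; F2]).
Proof.
rewrite alphaE; have bV := face_vertex bFm.
have [t0 ht0] := star_hamiltonian bV.
apply: (cycle_exhausts adj_sym (star_degree b) alpha_uniq _ _ _ ht0).
(* The length is at least 4: [s = 1] would give [F2 = Fm], and the arc to [F1] would have both
   colours. *)
- rewrite size_alpha (leq_trans (isT : 2 < 2 * 2)) // leq_pmul2l //.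
  rewrite ltn_neqAle order_gt0 andbT eq_sym order_eq1.
  apply: contraNneq un_m1 => s1; rewrite setUC.
  by move: col_12; rewrite -gFm -/s s1 perm1.
- have [] := alpha_path 0 n; rewrite -/t add0n /y expg_order -(expg0 s) => pt lt.
  by rewrite (cycle_path (y 0)) /y; case: (t) pt lt => //= ? ? ? ->.
by move=> F /flatten_mapP[i _]; rewrite in_set !inE => /orP[]/eqP->; apply: alpha_mem.
Qed.

End AlphaCycle.

Lemma flag_colouring_cover :
  cover22 e (lambda_aut X) coloured_arcs uncoloured_arcs (vertex_defining_cycles X).
Proof.
have [F1 _] := exists_face; have [a aF aA] := coloured_vertex F1.
have [b [c [bF cF ba ca bc]]] := face_other2 aF.
have nA p : p \in val F1 -> p != a -> p \notin A.
  by move=> pF; apply: contra => pA; apply/eqP; apply: colour_unique pF aF pA aA.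
have bA := nA b bF ba; have cA := nA c cF ca.
(* [F2] is opposite [c] and [Fm] is opposite [a], so both still contain [b], and [g] can be chosen
   to carry [Fm] to [F2] while fixing [b]. *)
have [F2 e12 cF2] := exists_opposite cF; have [Fm eFm aFm] := exists_opposite aF.
have bF2 : b \in val F2 by apply: adj_in e12 cF cF2 bF bc.
have bFm : b \in val Fm by apply: adj_in eFm aF aFm bF ba.
have [_ _ flagT] := colA.
have [g [gA gFm gb]] := flagT Fm F2 b b bFm bF2 erefl.
have col12 : [set F1; F2] \in coloured_arcs by rewrite (coloured_arcE e12 cF cF2).
have un_m1 : [set Fm; F1] \notin coloured_arcs.
  by rewrite setUC (coloured_arcE eFm aF aFm) aA.
have eFm1 : e Fm F1 by rewrite adj_sym.
have aV := face_vertex aF; have bV := face_vertex bF.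
have ham := alpha_hamiltonian bA gA gb bFm bF eFm1 e12 gFm un_m1 col12.
exists Fm, F1, F2, (lambda X g), (star_cycle a); split.
- by split=> //; apply/setDP; rewrite (in_arcs adj_sym).
- by rewrite mem_lambda_aut.
- split; first exact: star_cycle_in_graph_cycles.
  apply/orP; left; rewrite star_cycle_arcs //; apply/subsetP=> B /setIdP[BE Ba].
  by apply/setIdP; split=> //; apply/exists_inP; exists a.
- rewrite (cyc_of_hamiltonian adj_sym (star_degree b) (card_star bV) ham).
  rewrite -/(star_cycle b) vertex_defining_cyclesE.
  (* Coloured vertices are the translates of [a], uncoloured ones those of [b], so the two orbits
     together are all vertex-defining cycles. *)
  apply/setP=> C; apply/imsetP/setUP.
    case=> p pV ->; have [F pF] := vertex_in_face pV.
    have [pA|pA] := boolP (p \in A); [left | right]; apply/imsetP.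
      have [h [hA _ <-]] := flagT F1 F a p aF pF (etrans aA (esym pA)).
      by exists (lambda X h); rewrite ?mem_lambda_aut ?act_star_cycle.
    have [h [hA _ <-]] := flagT F1 F b p bF pF (etrans (negPf bA) (esym (negPf pA))).
    by exists (lambda X h); rewrite ?mem_lambda_aut ?act_star_cycle.
  case=> /imsetP[h]; rewrite lambda_autE => /imsetP[k kA ->] ->.
    by rewrite act_star_cycle //; exists (k a); rewrite ?aut_vertex.
  by rewrite act_star_cycle //; exists (k b); rewrite ?aut_vertex.
split; [exact: vertex_cycles_double_cover | exact: vertex_cycles_faithful].
Qed.

End FlagColouring.

(** * Assembly of the equivalence *)

Lemma vf22_cover :
    face_transitive X -> vf X = (2, 2) ->
  group22 e (lambda_aut X) /\
  is_C22 e (lambda_aut X) (vertex_defining_cycles X).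
Proof.
move=> tr vf22; have [A colA] := vf22_flag_colouring tr vf22.
have orbs := flag_colouring_orbits colA; have cov := flag_colouring_cover colA.
have trH : [transitive lambda_aut X, on [set: face X] | 'P].
  exact/lambda_aut_transitiveP.
split; last by exists (coloured_arcs A), (uncoloured_arcs A).
split.
- split; [exact: face_graph_simple_connected | exact: face_graph_cubic |].
  have [F0 _] := exists_face; apply/imsetP; exists F0; rewrite ?inE //.
  apply/eqP; rewrite eq_sym eqEsubset subsetT -(atransP trH F0) ?inE //.
  exact/imsetS/lambda_aut_sub.
- exact: lambda_aut_sub.
- split=> //; have [F vfE'] := vfE; have := card_face_stabilizer F tr.
  by move: vf22; rewrite vfE' => -[_ ->]; rewrite card_lambda_aut mulnC.
exists (coloured_arcs A), (uncoloured_arcs A); split=> //.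
by exists (vertex_defining_cycles X).
Qed.

End SurfaceStructure.

Theorem theorem4p8 (P : finType) (X : {set {set P}}) :
  simplicial_surface X ->
  (face_transitive X /\ vf X = (2, 2)) <->
  (group22 (face_graph X) (lambda_aut X) /\
   is_C22 (face_graph X) (lambda_aut X) (vertex_defining_cycles X)).
Proof.
move=> surfX; split=> [[tr vf22]|[H22 C22]]; first exact: vf22_cover.
exact: cover22_vf.
Qed.
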